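(* Let $q$, $\Xi=\{\xi_j\}_{j\ge0}$, $S=\{s_j\}_{j\ge0}$ be generic nonzero complex parameters. 1. For any $M\ge0$, $\mu\in\mathrm{Sign}_M^+$ and (generic) $u_1,\dots,u_M\in\mathbb C$, $$F_\mu(u_1,\dots,u_M\,|\,\Xi,S)=\sum_{\sigma\in\mathfrak S_M}\sigma\Bigg(\prod_{1\le\alpha<\beta\le M}\frac{u_\alpha-qu_\beta}{u_\alpha-u_\beta}\prod_{i=1}^M\varphi_{\mu_i}(u_i\,|\,\Xi,S)\Bigg),$$ where $\sigma$ acts by permuting the $u_i$. 2. Let $n\ge0$, $\nu\in\mathrm{Sign}_n^+$, and let $k$ be the number of zero coordinates of $\nu$. Then for any $N\ge n-k$ and (generic) $v_1,\dots,v_N\in\mathbb C$, $$G_\nu(v_1,\dots,v_N\,|\,\Xi,S)=\frac{(s_0^2;q)_n}{(q;q)_{N-n+k}(s_0^2;q)_k}\sum_{\sigma\in\mathfrak S_N}\sigma\Bigg(\prod_{1\le\alpha<\beta\le N}\frac{v_\alpha-qv_\beta}{v_\alpha-v_\beta}\prod_{j=1}^N\varphi_{\nu_j}(v_j\,|\,\Xi,S)\prod_{i=1}^{n-k}\frac{\xi_0v_i}{\xi_0v_i-s_0}\prod_{j=n-k+1}^{N}(1-s_0q^k\xi_0v_j)\Bigg),$$ where $\sigma$ permutes the $v_j$ and, by agreement, $\nu_j=0$ for $j>n$. If $N<n-k$, then $G_\nu(v_1,\dots,v_N\,|\,\Xi,S)=0$.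
   Context: $\mathrm{Sign}_N^+$ is the set of integer sequences $\lambda_1\ge\dots\ge\lambda_N\ge0$; $m_x(\lambda)$ is the number of parts of $\lambda$ equal to $x$. $(z;q)_m=\prod_{i=0}^{m-1}(1-zq^i)$. ''Generic'' means no denominators occurring vanish. $$\varphi_k(u\,|\,\Xi,S)=\frac{1-q}{1-s_k\xi_ku}\prod_{j=0}^{k-1}\frac{\xi_ju-s_j}{1-s_j\xi_ju},\qquad k\ge0.$$ Vertex weights: for $g\in\mathbb Z_{\ge0}$, $w_{u,s}(g,0;g,0)=\frac{1-sq^gu}{1-su}$, $w_{u,s}(g+1,0;g,1)=\frac{(1-s^2q^g)u}{1-su}$, $w_{u,s}(g,1;g,1)=\frac{u-sq^g}{1-su}$, $w_{u,s}(g,1;g+1,0)=\frac{1-q^{g+1}}{1-su}$; all other $w_{u,s}(i_1,j_1;i_2,j_2)$ are $0$. Partition functions. Given $\lambda,\mu$ and $n\ge0$, consider arrow configurations on $\mathbb Z_{\ge0}\times\{1,\dots,n\}$: nonnegative integers $a_y(x)$ ($0\le y\le n$, $x\ge0$; number of vertical arrows from $(x,y)$ to $(x,y+1)$) and $h_y(x)\in\{0,1\}$ ($1\le y\le n$, $x\ge0$; number of horizontal arrows from $(x-1,y)$ to $(x,y)$), finitely many of them nonzero, with $a_0(x)=m_x(\lambda)$, $a_n(x)=m_x(\mu)$. The weight of a configuration is $\prod_{y=1}^n\prod_{x\ge0}w_{\xi_xu_y,s_x}(a_{y-1}(x),h_y(x);a_y(x),h_y(x+1))$. $G_{\mu/\lambda}(u_1,\dots,u_n\,|\,\Xi,S)$,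 for $\lambda,\mu\in\mathrm{Sign}_N^+$, is the sum of weights over configurations with $h_y(0)=0$ for all $y$. $F_{\mu/\lambda}(u_1,\dots,u_n\,|\,\Xi,S)$, for $\lambda\in\mathrm{Sign}_N^+$, $\mu\in\mathrm{Sign}_{N+n}^+$, is the sum over configurations with $h_y(0)=1$ for all $y$. (Equivalently, sums over collections of up-right lattice paths.) Abbreviate $F_\mu=F_{\mu/\varnothing}$, and $G_\nu=G_{\nu/(0,\dots,0)}$ for $\nu\in\mathrm{Sign}_n^+$ (with $n$ zeros). *)

(* Defs.v *)
From HB Require Import structures.
From mathcomp Require Import all_boot all_order all_algebra all_fingroup.
From mathcomp Require Import all_classical all_reals.
From mathcomp Require Export complex.

Set Implicit Arguments.
Unset Strict Implicit.
Unset Printing Implicit Defensive.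

Import GRing.Theory.
Local Open Scope classical_set_scope.
Local Open Scope ring_scope.

(* All indices are 0-based: the i-th part of l is [nth 0 l i], which is 0 past
   the end of l. *)
Definition signature (N : nat) : Type :=
  {l : N.-tuple nat | sorted geq l}.

Definition parts (N : nat) (la : signature N) : seq nat := tval (val la).

Definition mult (N : nat) (x : nat) (la : signature N) : nat :=
  count_mem x (parts la).

Lemma sorted_nseq0 (N : nat) : sorted geq (nseq_tuple N 0%N).
Proof. by case: N => //= N; elim: N => //= N ->; rewrite /geq /= leqnn. Qed.

Definition zeros (N : nat) : signature N :=
  exist (fun l : N.-tuple nat => sorted geq l) (nseq_tuple N 0%N)
    (sorted_nseq0 N).

Section HigherSpin.
Context {F : fieldType}.

Definition qpoch (z q : F) (m : nat) : F := \prod_(i < m) (1 - z * q ^+ i).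

Definition phi (q : F) (xi s : nat -> F) (k : nat) (u : F) : F :=
  (1 - q) / (1 - s k * xi k * u) *
  \prod_(j < k) ((xi j * u - s j) / (1 - s j * xi j * u)).

Definition vertex_weight (q u s : F) (i1 : nat) (j1 : bool)
    (i2 : nat) (j2 : bool) : F :=
  match j1, j2 with
  | false, false => if i1 == i2 then (1 - s * q ^+ i1 * u) / (1 - s * u) else 0
  | false, true =>
      if i1 == i2.+1 then (1 - s ^+ 2 * q ^+ i2) * u / (1 - s * u) else 0
  | true, true => if i1 == i2 then (u - s * q ^+ i1) / (1 - s * u) else 0
  | true, false => if i2 == i1.+1 then (1 - q ^+ i1.+1) / (1 - s * u) else 0
  end.

(* A pair (a, h): a y x for 0 <= y <= n, and h y x for the row y + 1, y < n. *)
Definition config (n : nat) : Type :=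
  (('I_n.+1 -> nat -> nat) * ('I_n -> nat -> bool))%type.

Definition configs (n K L : nat) (la : signature K) (mu : signature L)
    (b : bool) : set (config n) :=
  [set c : config n |
           [/\ finite_set [set p : 'I_n.+1 * nat | c.1 p.1 p.2 <> 0%N],
               finite_set [set p : 'I_n * nat | c.2 p.1 p.2 = true],
               forall x, c.1 ord0 x = mult x la,
               forall x, c.1 ord_max x = mult x mu
             & forall y, c.2 y 0%N = b]].

(* The product over all x >= 0 has finitely many factors different from 1 as
   soon as no denominator 1 - s x * xi x * u y vanishes. *)
Definition config_weight (q : F) (xi s : nat -> F) (n : nat) (u : 'I_n -> F)
    (c : config n) : F :=
  \prod_(y < n) \big[*%R/1]_(x \in [set: nat])
    vertex_weight q (xi x * u y) (s x)
      (c.1 (inord y) x) (c.2 y x) (c.1 (inord y.+1) x) (c.2 y x.+1).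

Definition skewG (q : F) (xi s : nat -> F) (N n : nat)
    (mu la : signature N) (u : 'I_n -> F) : F :=
  \sum_(c \in @configs n N N la mu false) config_weight q xi s u c.

Definition skewF (q : F) (xi s : nat -> F) (N n : nat)
    (mu : signature (N + n)) (la : signature N) (u : 'I_n -> F) : F :=
  \sum_(c \in @configs n N (N + n) la mu true) config_weight q xi s u c.

Definition Ffun (q : F) (xi s : nat -> F) (M : nat) (mu : signature M)
    (u : 'I_M -> F) : F :=
  @skewF q xi s 0 M mu (zeros 0) u.

Definition Gfun (q : F) (xi s : nat -> F) (n N : nat) (nu : signature n)
    (v : 'I_N -> F) : F :=
  @skewG q xi s n N nu (zeros n) v.

Definition symmetrize (n : nat) (f : ('I_n -> F) -> F) (u : 'I_n -> F) : F :=
  \sum_(sg : 'S_n) f (fun i => u (sg i)).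

Definition cross (q : F) (n : nat) (u : 'I_n -> F) : F :=
  \prod_(a < n) \prod_(b < n | (a < b)%N) ((u a - q * u b) / (u a - u b)).

End HigherSpin.

(* Main.v *)
Require Import Defs.
From HB Require Import structures.
From mathcomp Require Import all_boot all_order all_algebra all_fingroup.
From mathcomp Require Import all_classical all_reals.
From mathcomp Require Import complex ring.

(* Let A(u) and B(u) be the transfer operators of one row whose leftmost
   horizontal edge is empty, resp. occupied.  They satisfy the Yang-Baxter
   exchange relations: the A's commute, the B's commute, and
     A(u)B(v) = (v - qu)/(v - u) B(v)A(u) + (1 - q)u/(u - v) B(u)A(v).
   F is a matrix element of B(u_M)...B(u_1) on the vacuum.  The operator E
   lowering by one the number of arrows in the leftmost column satisfies
     E B(v) = (q - s xi v)/(1 - s xi v) B(v) E + (1 - q)/(1 - s xi v) A(v),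
   so commuting E through B(u_M)...B(u_1) removes one smallest part of mu
   together with one of the u's; this is also the recursion obtained from the
   symmetrization by fixing which u sits at the last position.
   G is a matrix element of A(v_N)...A(v_1) on n arrows in column 0.  The
   exchange relations in the columns x >= 1 give a similar recursion removing
   one v, down to the case N = n - k, where every row carries an arrow out of
   column 0 and G is a multiple of an F on the columns x >= 1. *)

Set Implicit Arguments.
Unset Strict Implicit.
Unset Printing Implicit Defensive.

Import GRing.Theory.
Local Open Scope ring_scope.

(** * Row operators *)

Section RowOperators.
Context {F : fieldType} (q : F) (xi s : nat -> F).
Implicit Types (x b k n : nat) (u v w : F) (us vs : seq F) (bs : seq nat)
  (f g : seq nat -> F).

Definition den x u := 1 - s x * xi x * u.

(* [row x false u] and [row x true u] are A(u) and B(u) restricted to the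
   columns >= [x], acting on functions of the occupation numbers: [f] depends
   on the state below the row, the result on the state [bs] above it.  For
   [b = 0] the junk value [b.-1] is harmless, its coefficient [1 - q ^+ 0]
   being 0. *)
Fixpoint row x (j : bool) u f bs {struct bs} : F :=
  match bs with
  | [::] => if j then 0 else f [::]
  | b :: bs' =>
    if j then
      (1 - q ^+ b) / den x u * row x.+1 false u (fun c => f (b.-1 :: c)) bs'
      + (xi x * u - s x * q ^+ b) / den x u
        * row x.+1 true u (fun c => f (b :: c)) bs'
    else
      (1 - s x * q ^+ b * (xi x * u)) / den x u
        * row x.+1 false u (fun c => f (b :: c)) bs'
      + (1 - s x ^+ 2 * q ^+ b) * (xi x * u) / den x u
        * row x.+1 true u (fun c => f (b.+1 :: c)) bs'
  end.

Lemma row_lin x j u a1 a2 f g bs :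
  row x j u (fun c => a1 * f c + a2 * g c) bs =
  a1 * row x j u f bs + a2 * row x j u g bs.
Proof.
elim: bs x j f g => [|b bs IH] x [] f g /=; rewrite ?mulr0 ?addr0 // !IH; ring.
Qed.

(** * Exchange relations of the row operators *)

Definition fex u v := (v - q * u) / (v - u).
Definition gex u v := (1 - q) * u / (u - v).

(** Induction on the columns. Peeling column [x] off a product of two rows leaves two-row products
    on the columns to the right, and all four relations there enter, so they are proved together. A
    rational identity remains in each case. *)
Lemma row_exchange x u v f bs :
  u - v != 0 -> (forall y, den y u != 0) -> (forall y, den y v != 0) ->
  [/\ row x false u (row x false v f) bs = row x false v (row x false u f) bs,
      row x true u (row x true v f) bs = row x true v (row x true u f) bs,
      row x false u (row x true v f) bs =
        fex u v * row x true v (row x false u f) bs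
        + gex u v * row x true u (row x false v f) bs
    & row x false v (row x true u f) bs =
        fex v u * row x true u (row x false v f) bs
        + gex v u * row x true v (row x false u f) bs].
Proof.
move=> huv hu hv.
have hvu : v - u != 0 by rewrite -opprB oppr_eq0.
elim: bs x f => [|b bs IH] x f /=; first by split; rewrite ?mulr0 ?addr0.
rewrite !row_lin.
have hux := hu x; have hvx := hv x.
split.
- have [AA0 _ _ _] := IH x.+1 (fun c => f (b :: c)).
  have [_ _ AB1 BA1] := IH x.+1 (fun c => f (b.+1 :: c)).
  have [_ BB2 _ _] := IH x.+1 (fun c => f (b.+2 :: c)).
  rewrite AA0 AB1 BA1 BB2 /fex /gex /den in hux hvx *; rewrite !exprS !expr0.
  field; rewrite ?hux hvx huv hvu //.
- have [_ BB0 _ _] := IH x.+1 (fun c => f (b :: c)).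
  have [_ _ AB1 BA1] := IH x.+1 (fun c => f (b.-1 :: c)).
  have [AA2 _ _ _] := IH x.+1 (fun c => f (b.-2 :: c)).
  rewrite AA2 AB1 BA1 BB0 /fex /gex /den in hux hvx *.
  (* For [b = 0] the predecessors are junk with coefficient 0; for positive [b] they simplify. *)
  case: b {AA2 AB1 BA1 BB0} => [|b] /=; rewrite ?exprS;
  field; rewrite ?hux hvx huv hvu //.
- have [_ _ AB0 BA0] := IH x.+1 (fun c => f (b :: c)).
  have [AA1 _ _ _] := IH x.+1 (fun c => f (b.-1 :: c)).
  have [_ BB1 _ _] := IH x.+1 (fun c => f (b.+1 :: c)).
  case: b AB0 BA0 AA1 BB1 => [|b] /= AB0 BA0 AA1 BB1;
  rewrite AB0 ?BA0 AA1 BB1 /fex /gex /den in hux hvx *;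
  rewrite ?exprS;
  field; rewrite ?hux hvx huv hvu //.
- have [_ _ AB0 BA0] := IH x.+1 (fun c => f (b :: c)).
  have [AA1 _ _ _] := IH x.+1 (fun c => f (b.-1 :: c)).
  have [_ BB1 _ _] := IH x.+1 (fun c => f (b.+1 :: c)).
  case: b AB0 BA0 AA1 BB1 => [|b] /= AB0 BA0 AA1 BB1;
  rewrite BA0 ?AB0 AA1 BB1 /fex /gex /den in hux hvx *;
  rewrite ?exprS;
  field; rewrite ?hux hvx huv hvu //.
Qed.

Lemma rowD x j u f g bs :
  row x j u (fun c => f c + g c) bs = row x j u f bs + row x j u g bs.
Proof.
have := row_lin x j u 1 1 f g bs; rewrite !mul1r => <-.
by congr (row _ _ _ _ _); apply/funext => c; rewrite !mul1r.
Qed.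

Lemma rowZ x j u a f bs : row x j u (fun c => a * f c) bs = a * row x j u f bs.
Proof.
have := row_lin x j u a 0 f f bs; rewrite mul0r addr0 => <-.
by congr (row _ _ _ _ _); apply/funext => c; rewrite mul0r addr0.
Qed.

Lemma row0 x j u bs : row x j u (fun=> 0) bs = 0.
Proof.
rewrite -[RHS](mul0r (row x j u (fun=> 0) bs)) -rowZ.
by congr (row _ _ _ _ _); apply/funext => c; rewrite mul0r.
Qed.

Lemma row_sum x j u (I : Type) (r : seq I) (a : I -> F)
    (f : I -> seq nat -> F) bs :
  row x j u (fun c => \sum_(i <- r) a i * f i c) bs =
  \sum_(i <- r) a i * row x j u (f i) bs.
Proof.
elim: r => [|i r IH].
  rewrite big_nil -[RHS](row0 x j u bs).
  by congr (row _ _ _ _ _); apply/funext => c; rewrite big_nil.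
rewrite big_cons -IH -rowZ -rowD.
by congr (row _ _ _ _ _); apply/funext => c; rewrite big_cons.
Qed.

Fixpoint picks us : seq (F * seq F) :=
  if us is v :: us' then (v, us') :: [seq (p.1, v :: p.2) | p <- picks us']
  else [::].

Lemma perm_picks us p : p \in picks us -> perm_eq (p.1 :: p.2) us.
Proof.
elim: us p => //= v us IH p; rewrite inE => /predU1P[-> //|/mapP[p' /IH hp' ->]] /=.
rewrite -(cat1s p'.1) -(cat1s v) perm_catCA /= perm_cons; exact: hp'.
Qed.

Definition admissible us := uniq us /\ {in us, forall u y, den y u != 0}.

Lemma perm_admissible us vs : perm_eq us vs -> admissible vs -> admissible us.
Proof.
move=> e [un d]; split; first by rewrite (perm_uniq e).
by move=> u; rewrite (perm_mem e); apply: d.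
Qed.

Lemma admissible_cons v us : admissible (v :: us) ->
  [/\ admissible us, v \notin us & forall y, den y v != 0].
Proof.
case=> /= /andP[vn un] d; split => //.
  by split=> // u hu; apply: d; rewrite inE hu orbT.
by apply: d; rewrite inE eqxx.
Qed.

Lemma admissible_pick us p : p \in picks us -> admissible us -> admissible (p.1 :: p.2).
Proof. by move/perm_picks/perm_admissible. Qed.

Lemma admissible_cons2 v w us : admissible (v :: w :: us) ->
  [/\ admissible (v :: us), admissible (w :: us), v - w != 0, forall y, den y v != 0
    & forall y, den y w != 0].
Proof.
move=> ha; have [hw hv dv] := admissible_cons ha; have [_ _ dw] := admissible_cons hw.
have e : perm_eq (w :: v :: us) (v :: w :: us).
  by rewrite -(cat1s w) -(cat1s v) perm_catCA.
have [hvu _ _] := admissible_cons (perm_admissible e ha); split=> //.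
by rewrite subr_eq0; apply: contraNneq hv => ->; rewrite inE eqxx.
Qed.

Lemma admissible_cons_pick v us p : p \in picks us -> admissible (v :: us) ->
  [/\ admissible (v :: p.2), admissible (p.1 :: p.2), v - p.1 != 0, forall y, den y v != 0
    & forall y, den y p.1 != 0].
Proof.
move=> /perm_picks e ha; apply: admissible_cons2; apply: perm_admissible ha.
by rewrite perm_cons.
Qed.

Definition fprod u us := \prod_(w <- us) fex u w.

(** * The operators B applied to the vacuum *)

Definition vac bs : F := (all (pred1 0%N) bs)%:R.

Lemma row_vac x u bs : (forall y, den y u != 0) -> row x false u vac bs = vac bs.
Proof.
move=> hu; elim: bs x => //= b bs IH x.
rewrite (_ : (fun c => vac (b.+1 :: c)) = fun=> 0) // row0 mulr0 addr0.
case: b => [|b].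
  rewrite expr0 mulr1 mulrA divff ?hu // mul1r.
  by rewrite -[RHS](IH x.+1).
by rewrite (_ : (fun c => vac (b.+1 :: c)) = fun=> 0) // row0 mulr0.
Qed.

(** The head of [us] is the parameter of the topmost row, the last one to act. *)
Definition Psi x us : seq nat -> F := foldr (row x true) vac us.

(** The algebraic Bethe ansatz: A(v) moves to the right through the B's and is absorbed by the
    vacuum. The first term is the one in which [v] is never exchanged; in the others [v] has
    replaced one of the [us]. *)
Lemma rowA_Psi x v us bs : admissible (v :: us) ->
  row x false v (Psi x us) bs = fprod v us * Psi x us bs
   + \sum_(p <- picks us) gex v p.1 * fprod p.1 p.2 * Psi x (v :: p.2) bs.
Proof.
elim: us v bs => [|w us IH] v bs ha.
  by rewrite /fprod !big_nil mul1r addr0 row_vac //; case: (admissible_cons ha).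
have [hvu hwu hvw dv dw] := admissible_cons2 ha.
have [_ _ E _] := row_exchange x (Psi x us) bs hvw dv dw.
rewrite [LHS]E.
have -> : row x false v (Psi x us) = fun bs => fprod v us * Psi x us bs
   + \sum_(p <- picks us) gex v p.1 * fprod p.1 p.2 * Psi x (v :: p.2) bs.
  by apply/funext => c; exact: IH.
have -> : row x false w (Psi x us) = fun bs => fprod w us * Psi x us bs
   + \sum_(p <- picks us) gex w p.1 * fprod p.1 p.2 * Psi x (w :: p.2) bs.
  by apply/funext => c; exact: IH.
rewrite !rowD !rowZ !row_sum /fprod /= !big_cons big_map -/(fprod v us) -/(fprod w us).
rewrite !mulrDr !mulr_sumr addrACA -[X in _ + _ + X]big_split /= !mulrA addrA.
congr (_ + _); apply: eq_big_seq => p hp.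
have [_ _ h3 _ h4] := admissible_cons_pick hp hvu.
have [_ _ h5 _ _] := admissible_cons_pick hp hwu.
(* As B(v) and B(w) commute, the two contributions that drop [p.1] are multiples of the same vector,
   so only their coefficients need comparing. *)
have [_ BB _ _] := row_exchange x (Psi x p.2) bs hvw dv dw.
rewrite big_cons -/(fprod p.1 p.2) /= -BB /gex /fex.
have ? : w - v != 0 by rewrite -opprB oppr_eq0.
field; rewrite ?hvw ?h3 ?h5 //.
Qed.

(* The relation between E and B of the header; [f] is precomposed with the
   addition of an arrow in column [x]. *)
Lemma shift_B x v f b bs : den x v != 0 ->
  row x true v f (b.+1 :: bs) =
  (q - s x * xi x * v) / den x v
    * row x true v (fun c => f ((head 0%N c).+1 :: behead c)) (b :: bs)
  + (1 - q) / den x v * row x false v f (b :: bs).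
Proof.
move=> hv /=; case: b => [|b] /=; rewrite ?exprS ?expr0 /den in hv *;
field; rewrite hv //.
Qed.

(** By [shift_B], lowering column [x] on B(v) either passes to the remaining rows (induction) or
    leaves A(v), expanded by [rowA_Psi]. The first term of that expansion is the pick of [v]; for
    any other pick the two contributions add up. *)
Lemma Psi_succ x us b bs : admissible us ->
  Psi x us (b.+1 :: bs) =
  \sum_(p <- picks us)
     (1 - q) / den x p.1 * fprod p.1 p.2 * Psi x p.2 (b :: bs).
Proof.
elim: us b bs => [|v us IH] b bs ha; first by rewrite big_nil.
have [hu hv dv] := admissible_cons ha.
rewrite [LHS]shift_B ?dv // rowA_Psi //.
rewrite (_ : row _ _ _ _ _ = row x true v (fun c => \sum_(p <- picks us)
     (1 - q) / den x p.1 * fprod p.1 p.2 * Psi x p.2 c) (b :: bs)); last first.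
  by rewrite /=; congr (_ * row _ _ _ _ _ + _ * row _ _ _ _ _); apply/funext => c;
     exact: IH.
rewrite row_sum big_cons big_map /= -/(fprod v us) mulrDr mulr_sumr mulrA addrCA.
congr (_ + _); rewrite mulr_sumr -big_split /=; apply: eq_big_seq => p hp.
have [_ _ h3 _ h4] := admissible_cons_pick hp ha.
rewrite [fprod p.1 (v :: _)]big_cons -/(fprod p.1 p.2) /gex /fex.
move: (h4 x) (dv x); rewrite /den => h4x dvx.
field; rewrite h3 h4x dvx //.
Qed.

(** With no arrow at the top of column [x], the factor [1 - q ^+ 0] kills every turn upwards, so
    each row crosses the column straight. *)
Lemma Psi_zero x us bs :
  Psi x us (0%N :: bs) =
  (\prod_(u <- us) ((xi x * u - s x) / den x u)) * Psi x.+1 us bs.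
Proof.
elim: us bs => [|v us IH] bs /=; first by rewrite big_nil mul1r.
rewrite expr0 subrr !mul0r add0r mulr1 big_cons -[RHS]mulrA; congr (_ * _).
by rewrite -rowZ; congr row; apply/funext => c; rewrite -IH.
Qed.

(* The symmetrization of a product, by recursion on the choice of the variable
   put at the last position; [hs] lists the factors from the last one on. *)
Fixpoint Sym (hs : seq (F -> F)) us : F :=
  if hs is h :: hs' then
    \sum_(p <- picks us) h p.1 * fprod p.1 p.2 * Sym hs' p.2
  else (us == [::])%:R.

(** Each step of [Sym] consumes one variable and one factor, so a product over all variables
    distributes over the factors. *)
Lemma Sym_scale (r : F -> F) hs us :
  (\prod_(u <- us) r u) * Sym hs us = Sym [seq (fun u => r u * h u) | h <- hs] us.
Proof.
elim: hs us => [|h hs IH] us /=.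
  by case: us => [|u us]; rewrite ?big_nil ?mul1r ?mulr0.
rewrite mulr_sumr; apply: eq_big_seq => p hp.
rewrite -(perm_big _ (perm_picks hp)) big_cons -IH /=; ring.
Qed.

Lemma eq_Sym (I : eqType) (r : seq I) (h1 h2 : I -> F -> F) us :
  {in r & us, forall i u, h1 i u = h2 i u} ->
  Sym (map h1 r) us = Sym (map h2 r) us.
Proof.
elim: r us => //= i r IH us e; apply: eq_big_seq => p hp.
have m := perm_mem (perm_picks hp).
rewrite e -?m ?inE ?eqxx //; congr (_ * _); apply: IH => j u hj hu.
by apply: e; rewrite -?m inE ?hj ?hu orbT.
Qed.

(** The function φ_k of the system whose leftmost column is [x]. *)
Definition phi_from x k u :=
  (1 - q) / den k u * \prod_(x <= j < k) ((xi j * u - s j) / den j u).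

(** Recovers from the occupation numbers the positions of the arrows, in increasing order. *)
Fixpoint columns x bs : seq nat :=
  if bs is b :: bs' then nseq b x ++ columns x.+1 bs' else [::].

Lemma columns_ge x bs k : k \in columns x bs -> (x <= k)%N.
Proof.
elim: bs x => //= b bs IH x; rewrite mem_cat mem_nseq => /orP[/andP[_ /eqP->]//|].
by move/IH/ltnW.
Qed.

(** An empty first column multiplies every [phi_from x.+1 k] by its missing factor; an occupied one
    loses an arrow by [Psi_succ], whose coefficient is [phi_from x x]. *)
Lemma Psi_Sym x bs us : admissible us ->
  Psi x us bs = Sym [seq phi_from x k | k <- columns x bs] us.
Proof.
elim: bs x us => [|b bs IH] x us ha; first by case: us ha.
elim: b us ha => [|b IHb] us ha.
  rewrite Psi_zero IH // Sym_scale -map_comp; apply: eq_Sym => k u hk _ /=.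
  by rewrite /phi_from (big_ltn (columns_ge hk)) mulrCA.
rewrite Psi_succ //; apply: eq_big_seq => p hp.
have [h _ _] := admissible_cons (admissible_pick hp ha).
by rewrite IHb // /phi_from big_geq // mulr1.
Qed.

(** * The operators A applied to arrows in a single column *)

Definition start n bs : F :=
  if bs is b :: bs' then (b == n)%:R * vac bs' else 0.

Definition Omega x n vs : seq nat -> F := foldr (row x false) (start n) vs.

Lemma row_Omega x n y j u w vs k bs :
  row y j u (fun c => Omega x n (w :: vs) (k :: c)) bs =
  (1 - s x * q ^+ k * (xi x * w)) / den x w
    * row y j u (row x.+1 false w (fun c => Omega x n vs (k :: c))) bs
  + (1 - s x ^+ 2 * q ^+ k) * (xi x * w) / den x w
    * row y j u (row x.+1 true w (fun c => Omega x n vs (k.+1 :: c))) bs.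
Proof. exact: row_lin. Qed.

(* Up to the factors [u] and [v], this is the operator A with parameter [u] in
   column [x] and [v] in the columns >= [x.+1]. *)
Definition mixed_row x k u v f bs :=
  u * ((1 - s x * q ^+ k * (xi x * u)) / den x u)
    * row x.+1 false v (fun c => f (k :: c)) bs
  + v * ((1 - s x ^+ 2 * q ^+ k) * (xi x * u) / den x u)
    * row x.+1 true v (fun c => f (k.+1 :: c)) bs.

(* The powers of [q] are kept on both sides because [size vs + k - n] may be
   negative. *)
Lemma rowA_Omega x n v vs k bs : admissible (v :: vs) ->
  q ^+ (size vs + k) * row x.+1 false v (fun c => Omega x n vs (k :: c)) bs =
  q ^+ n * (fprod v vs * Omega x n vs (k :: bs)
    + \sum_(p <- picks vs) (1 - q) / (v - p.1) * fprod p.1 p.2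
        * mixed_row x k p.1 v (Omega x n p.2) bs).
Proof.
elim: vs v k bs => [|w vs IH] v k bs ha.
  rewrite /fprod !big_nil mul1r addr0 add0n /= rowZ row_vac; last by case: (admissible_cons ha).
  by case: eqP => [->//|_]; rewrite !mul0r !mulr0.
have [hvu hwu hvw dv dw] := admissible_cons2 ha.
have hwv : w - v != 0 by rewrite -opprB oppr_eq0.
pose O j c := Omega x n vs (j :: c).
(* The induction hypothesis carried by linearity under one more row. *)
have IHr j t z k' cs : z \in [:: v; w] ->
    q ^+ (size vs + k') * row x.+1 j t (row x.+1 false z (O k')) cs =
    q ^+ n * (fprod z vs * row x.+1 j t (O k') cs
     + \sum_(p <- picks vs) (1 - q) / (z - p.1) * fprod p.1 p.2
        * row x.+1 j t (mixed_row x k' p.1 z (Omega x n p.2)) cs).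
  move=> hz; rewrite -row_sum -[fprod z vs * row _ _ _ _ _]rowZ -rowD -!rowZ.
  congr row; apply/funext => c.
  by apply: IH; move: hz; rewrite !inE => /orP[]/eqP->.
(* A(v) and A(w) commute on the columns from [x.+1] on; expanding both orders by induction yields a
   linear relation that is not visible term by term. *)
have E0 : q ^+ n * (fprod v vs * row x.+1 false w (O k) bs
     + \sum_(p <- picks vs) (1 - q) / (v - p.1) * fprod p.1 p.2
        * row x.+1 false w (mixed_row x k p.1 v (Omega x n p.2)) bs) =
   q ^+ n * (fprod w vs * row x.+1 false v (O k) bs
     + \sum_(p <- picks vs) (1 - q) / (w - p.1) * fprod p.1 p.2
        * row x.+1 false v (mixed_row x k p.1 w (Omega x n p.2)) bs).
  rewrite -!IHr ?inE ?eqxx ?orbT //; congr (_ * _).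
  by case: (row_exchange x.+1 (O k) bs hwv dw dv).
set S1 := \sum_(p <- _) (1 - q) / (v - _) * _ * _ in E0.
set S2 := \sum_(p <- _) (1 - q) / (w - _) * _ * _ in E0.
have [AA _ _ _] := row_exchange x.+1 (O k) bs hvw dv dw.
have [_ _ AB _] := row_exchange x.+1 (O k.+1) bs hvw dv dw.
have H1 := IHr false w v k bs; have H2 := IHr true w v k.+1 bs.
have H3 := IHr true v w k.+1 bs.
rewrite !inE !eqxx orbT in H1 H2 H3.
move/(_ isT) in H1; move/(_ isT) in H2; move/(_ isT) in H3.
set S3 := \sum_(p <- _) _ in H2; set S4 := \sum_(p <- _) _ in H3.
rewrite -/S1 in H1.
pose al := (1 - s x * q ^+ k * (xi x * w)) / den x w.
pose ga := (1 - s x ^+ 2 * q ^+ k) * (xi x * w) / den x w.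
rewrite [picks _]/= big_cons big_map.
set S5 := \sum_(p <- _) _.
(* The sums agree pick by pick only after adding a multiple of [S2 - S1]; [E0] compensates for it at
   the end. *)
have key : (1 - q) * w / (v - w) * al * (S2 - S1) + q * al * S1
    + ga * (fex v w * S3 + gex v w * S4) = S5.
  rewrite -sumrB !mulr_sumr -!big_split /= mulr_sumr -big_split /=.
  apply: eq_big_seq => p hp.
  have [_ _ h3 _ h4] := admissible_cons_pick hp hvu.
  have [_ _ h5 _ _] := admissible_cons_pick hp hwu.
  rewrite [fprod p.1 (w :: _)]big_cons -/(fprod p.1 p.2) /mixed_row !row_lin -/(Omega x n p.2).
  have [AA0 _ _ _] :=
    row_exchange x.+1 (fun c => Omega x n p.2 (k :: c)) bs hvw dv dw.
  have [_ _ AB1 BA1] :=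
    row_exchange x.+1 (fun c => Omega x n p.2 (k.+1 :: c)) bs hvw dv dw.
  have [_ BB2 _ _] :=
    row_exchange x.+1 (fun c => Omega x n p.2 (k.+2 :: c)) bs hvw dv dw.
  rewrite AA0 AB1 BA1 BB2.
  move: (h4 x) (dv x) (dw x); rewrite /al /ga /fex /gex /den !exprS !expr0 => h4x dvx dwx.
  have ? : p.1 - w != 0 by rewrite -opprB oppr_eq0.
  field; rewrite ?h3 ?h5 ?h4x ?dvx ?dwx ?hvw ?hwv //.
rewrite -key row_Omega -/(O k) -/(O k.+1) AA AB -/al -/ga.
transitivity (q * al * (q ^+ (size vs + k) *
     row x.+1 false w (row x.+1 false v (O k)) bs)
   + ga * (fex v w * (q ^+ (size vs + k.+1) *
              row x.+1 true w (row x.+1 false v (O k.+1)) bs)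
         + gex v w * (q ^+ (size vs + k.+1) *
              row x.+1 true v (row x.+1 false w (O k.+1)) bs))).
  by rewrite addSn addnS !exprS; ring.
rewrite H1 H2 H3 /fprod big_cons -/(fprod v vs) -/(fprod w vs).
rewrite [(w, vs).1]/= [(w, vs).2]/= /mixed_row -/al -/ga -/(O k) -/(O k.+1).
have -> : Omega x n (w :: vs) (k :: bs) = al * row x.+1 false w (O k) bs
  + ga * row x.+1 true w (O k.+1) bs by [].
apply/eqP; rewrite -subr_eq0; apply/eqP.
set X := row x.+1 false w (O k) bs in E0 *.
set X' := row x.+1 false v (O k) bs in E0 *.
transitivity ((1 - q) * w / (v - w) * al * (q ^+ n * (fprod v vs * X + S1)
   - q ^+ n * (fprod w vs * X' + S2))).
  rewrite /fex /gex; field; rewrite ?hvw ?hwv //.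
by rewrite E0 subrr mulr0.
Qed.

(** The analogue of [Psi_succ]; the prefactor is q^n (1 - q^m), with m the number of rows in which
    no arrow leaves column [x]. In the induction, the term without an arrow leaving in row [v] has a
    power of q off by one; the resulting multiple of 1 - q is expanded by [rowA_Omega], whose first
    term is the pick of [v]. *)
Lemma Omega_peel x n vs k bs : admissible vs ->
  (q ^+ n - q ^+ (size vs + k)) * Omega x n vs (k :: bs) =
  q ^+ n * \sum_(p <- picks vs)
     (1 - q) / den x p.1 * (1 - s x * q ^+ k * xi x * p.1)
     * fprod p.1 p.2 * Omega x n p.2 (k :: bs).
Proof.
elim: vs k bs => [|v vs IH] k bs ha.
  rewrite big_nil add0n mulr0 /=.
  by case: eqP => [->|_]; rewrite ?subrr ?mul0r ?mulr0.
have [hu hv dv] := admissible_cons ha.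
have IHr j k' cs :
  (q ^+ n - q ^+ (size vs + k'))
    * row x.+1 j v (fun c => Omega x n vs (k' :: c)) cs =
  q ^+ n * \sum_(p <- picks vs)
     (1 - q) / den x p.1 * (1 - s x * q ^+ k' * xi x * p.1)
     * fprod p.1 p.2 * row x.+1 j v (fun c => Omega x n p.2 (k' :: c)) cs.
  rewrite -row_sum -!rowZ; congr row; apply/funext => c; exact: IH.
have H0 := IHr false k bs; have H1 := IHr true k.+1 bs.
have H2 := rowA_Omega x n k bs ha.
rewrite [picks _]/= big_cons big_map /=.
set S0 := \sum_(p <- _) _ in H0; set S1 := \sum_(p <- _) _ in H1.
set S2 := \sum_(p <- _) _ in H2; set S3 := \sum_(p <- _) _.
set X := row _ _ _ _ _ in H0 H2 *; set Y := row _ _ _ _ _ in H1 *.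
set O := Omega _ _ _ _ in H2 *.
pose al := (1 - s x * q ^+ k * (xi x * v)) / den x v.
pose ga := (1 - s x ^+ 2 * q ^+ k) * (xi x * v) / den x v.
have key : al * S0 + ga * S1 + (1 - q) * al * S2 = S3.
  rewrite !mulr_sumr -!big_split /=; apply: eq_big_seq => p hp.
  have [_ _ h3 _ h4] := admissible_cons_pick hp ha.
  rewrite [fprod p.1 (v :: _)]big_cons -/(fprod p.1 p.2) /mixed_row.
  move: (h4 x) (dv x); rewrite /al /ga /fex /den !exprS !expr0 => h4x dvx.
  field; rewrite ?h3 ?h4x ?dvx //.
rewrite -key -/al -/ga.
transitivity (al * ((q ^+ n - q ^+ (size vs + k)) * X)
   + ga * ((q ^+ n - q ^+ (size vs + k.+1)) * Y)
   + (1 - q) * al * (q ^+ (size vs + k) * X)).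
  by rewrite addSn addnS !exprS; ring.
rewrite H0 H1 H2 /al /den; ring.
Qed.

(** At most one arrow leaves column [x] per row, while [n - k] of them must leave. *)
Lemma Omega_few x n vs k bs : (size vs + k < n)%N -> Omega x n vs (k :: bs) = 0.
Proof.
elim: vs k bs => [|v vs IH] k bs /= h; first by rewrite ltn_eqF // mul0r.
rewrite (_ : (fun c => foldr _ _ _ (k :: c)) = fun=> 0); last first.
  by apply/funext => c; apply: IH; apply: ltnW.
rewrite (_ : (fun c => foldr _ _ _ (k.+1 :: c)) = fun=> 0); last first.
  by apply/funext => c; apply: IH; rewrite addnS.
by rewrite !row0 !mulr0 addr0.
Qed.

(** Every row must send an arrow out of column [x], so the columns from [x.+1] on see only occupied
    left edges, that is, [Psi]. *)
Lemma Omega_tight x n vs k bs : (size vs + k = n)%N ->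
  Omega x n vs (k :: bs) =
  (\prod_(i < size vs) (1 - s x ^+ 2 * q ^+ (k + i)))
  * (\prod_(v <- vs) (xi x * v / den x v)) * Psi x.+1 vs bs.
Proof.
elim: vs k bs => [|v vs IH] k bs /= h.
  by rewrite -h eqxx mul1r big_ord0 big_nil !mul1r.
rewrite (_ : (fun c => foldr _ _ _ (k :: c)) = fun=> 0); last first.
  by apply/funext => c; apply: Omega_few; rewrite -h addSn.
rewrite row0 mulr0 add0r.
rewrite (_ : (fun c => foldr _ _ _ (k.+1 :: c)) = fun c =>
  (\prod_(i < size vs) (1 - s x ^+ 2 * q ^+ (k.+1 + i)))
  * (\prod_(v <- vs) (xi x * v / den x v)) * Psi x.+1 vs c); last first.
  by apply/funext => c; apply: IH; rewrite -h addnS.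
rewrite rowZ big_ord_recl big_cons addn0.
rewrite [in RHS](eq_bigr (fun i : 'I_(size vs) =>
  1 - s x ^+ 2 * q ^+ (k.+1 + i))); last by move=> i _; rewrite lift0 addnS.
rewrite -/(Psi _ _); ring.
Qed.

(** Induction on the number [m] of rows without an arrow out of column [x]: [Omega_tight] is the
    base, and each use of [Omega_peel] contributes one factor of [qpoch q q m] and one entry of the
    [nseq]. *)
Lemma Omega_Sym x n m vs k bs : admissible vs -> q != 0 ->
  (size vs + k = n + m)%N -> (k <= n)%N ->
  qpoch q q m * Omega x n vs (k :: bs) =
  (\prod_(i < n - k) (1 - s x ^+ 2 * q ^+ (k + i))) *
  Sym (nseq m (fun v => (1 - q) / den x v * (1 - s x * q ^+ k * xi x * v))
       ++ [seq (fun v => xi x * v / den x v * phi_from x.+1 j v)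
              | j <- columns x.+1 bs]) vs.
Proof.
move=> ha hq hsz hk; elim: m vs ha hsz => [|m IH] vs ha hsz.
  rewrite /qpoch big_ord0 mul1r Omega_tight; last by rewrite hsz addn0.
  have -> : size vs = (n - k)%N by rewrite -(addn0 n) -hsz addnK.
  by rewrite -mulrA Psi_Sym // Sym_scale -map_comp.
have hn : q ^+ n != 0 by rewrite expf_neq0.
apply: (mulfI hn); rewrite /qpoch big_ord_recr /= -/(qpoch q q m) -exprS.
have E := Omega_peel x n k bs ha.
transitivity (qpoch q q m * ((q ^+ n - q ^+ (size vs + k)) * Omega x n vs (k :: bs))).
  by rewrite hsz exprD; ring.
rewrite E mulrCA; congr (_ * _); rewrite !mulr_sumr; apply: eq_big_seq => p hp.
have [h1 _ _] := admissible_cons (admissible_pick hp ha).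
rewrite mulrCA -mulrA IH //; last first.
  by have := perm_size (perm_picks hp); rewrite /= => e; apply: succn_inj;
     rewrite -addSn e hsz addnS.
by rewrite mulrCA.
Qed.

End RowOperators.

(** * Symmetrization over the symmetric group *)

Section Symmetrization.
Context {F : fieldType} (q : F).

Lemma codom_ordS n (u : 'I_n.+1 -> F) :
  codom u = u ord0 :: codom (fun i => u (lift ord0 i)).
Proof. by rewrite !codomE enum_ordSl /= -map_comp. Qed.

Lemma picks_codom n (u : 'I_n.+1 -> F) :
  picks (codom u) =
  [seq (u j, codom (fun i : 'I_n => u (lift j i))) | j <- enum 'I_n.+1].
Proof.
elim: n u => [|n IH] u; rewrite codom_ordS enum_ordSl /= -map_comp.
  by rewrite !codomE !enum_ord0.
rewrite {}IH -map_comp; congr (_ :: _); apply: eq_map => j /=; congr (_, _).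
rewrite (codom_ordS (fun i => u (lift (lift ord0 j) i))); congr (u _ :: _).
  exact: val_inj.
rewrite !codomE; apply: eq_map => i; congr u; apply: val_inj => /=.
by rewrite /bump /= !add1n ltnS addnS.
Qed.

(** The pairs containing the last index give the [fex] factors, as in the recursion of [Sym]. *)
Lemma cross_ordS n (w : 'I_n.+1 -> F) :
  cross q w = cross q (fun i : 'I_n => w (lift ord_max i))
    * \prod_(i < n) fex q (w ord_max) (w (lift ord_max i)).
Proof.
have wl (i : 'I_n) : widen_ord (leqnSn n) i = lift ord_max i.
  by apply: val_inj; rewrite [RHS]lift_max.
rewrite /cross big_ord_recr /= [X in _ * X]big1 ?mulr1; last first.
  by move=> i; rewrite ltnNge -ltnS ltn_ord.
rewrite -big_split; apply: eq_bigr => i _ /=.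
rewrite big_mkcond big_ord_recr /= ltn_ord wl; congr (_ * _).
rewrite -big_mkcond /=; apply: eq_big => j // _.
by rewrite wl.
Qed.

(** A permutation amounts to the image [j] of the last index together with a permutation of the
    other indices; summing over [j] is the sum over picks. *)
Lemma symmetrize_Sym n (h : nat -> F -> F) (u : 'I_n -> F) :
  symmetrize (fun w => cross q w * \prod_(i < n) h i (w i)) u =
  Sym q [seq h i | i <- rev (iota 0 n)] (codom u).
Proof.
elim: n u => [|n IH] u.
  rewrite /symmetrize (big_pred1 1%g) => [|p /=].
    by rewrite /cross !big_ord0 mulr1 codomE enum_ord0.
  by symmetry; apply/eqP/permP => -[].
have -> : rev (iota 0 n.+1) = n :: rev (iota 0 n) by rewrite -addn1 iotaD rev_cat.
rewrite /= picks_codom big_map big_enum /=.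
pose L (p : 'I_n.+1 * 'S_n) := lift_perm ord_max p.1 p.2.
have Lbij : bijective L.
  apply: inj_card_bij; last by rewrite card_prod card_ord !card_Sn factS.
  move=> [j t] [j' t'] e; have ej : j = j'.
    by have := congr1 (fun p : 'S_n.+1 => p ord_max) e; rewrite /L !lift_perm_id.
  congr (_, _) => //; apply/permP => i; apply: (@lift_inj _ j).
  have := congr1 (fun p : 'S_n.+1 => p (lift ord_max i)) e.
  by rewrite /L /= !lift_perm_lift -ej.
rewrite /symmetrize (reindex L) /=; last exact: onW_bij.
rewrite -(pair_bigA _ (fun j t => cross q (fun i => u (L (j, t) i))
  * \prod_(i < n.+1) h i (u (L (j, t) i)))) /=.
apply: eq_bigr => j _.
rewrite -IH /symmetrize mulr_sumr; apply: eq_bigr => t _.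
rewrite /L cross_ordS big_ord_recr /= lift_perm_id.
have wl (i : 'I_n) : widen_ord (leqnSn n) i = lift ord_max i.
  by apply: val_inj; rewrite [RHS]lift_max.
have -> : \prod_(i < n) fex q (u j) (u (lift_perm ord_max j t (lift ord_max i))) =
  fprod q (u j) (codom (fun i : 'I_n => u (lift j i))).
  rewrite /fprod codomE big_map big_enum /= [RHS](reindex_inj (@perm_inj _ t)) /=.
  by apply: eq_bigr => i _; rewrite lift_perm_lift.
have -> : cross q (fun i : 'I_n => u (lift_perm ord_max j t (lift ord_max i))) =
  cross q (fun i : 'I_n => u (lift j (t i))).
  by congr cross; apply/funext => i; rewrite lift_perm_lift.
have -> : \prod_(i < n) h i (u (lift_perm ord_max j t (widen_ord (leqnSn n) i))) =
   \prod_(i < n) h i (u (lift j (t i))).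
  by apply: eq_bigr => i _; rewrite wl lift_perm_lift.
ring.
Qed.

Lemma symmetrize_perm n (f : ('I_n -> F) -> F) (u : 'I_n -> F) (t : 'S_n) :
  symmetrize f (fun i => u (t i)) = symmetrize f u.
Proof.
rewrite /symmetrize [RHS](reindex_inj (mulIg t)); apply: eq_bigr => p _.
by congr f; apply/funext => i; rewrite permM.
Qed.

End Symmetrization.

(** * Arrow configurations *)

Section PathSums.
Context {F : fieldType} (q : F) (xi s : nat -> F).
Implicit Types (x b L n : nat) (u : F) (us : seq F) (bs : seq nat)
  (j : bool) (h : seq bool) (H : seq (seq bool)).

(** Candidates for the horizontal edges of a row, one to the right of each of [L] columns; the edge
    entering the first column is kept apart. *)
Fixpoint bits L : seq (seq bool) :=
  if L is L'.+1 then [seq j :: h | j <- [:: false; true], h <- bits L']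
  else [:: [::]].

Lemma mem_bits L h : (h \in bits L) = (size h == L).
Proof.
elim: L h => [|L IH] h; first by rewrite inE; case: h.
apply/allpairsP/eqP => [[[j h'] /= [_ hh ->]]|].
  by move: hh; rewrite IH /= => /eqP->.
case: h => //= j h [e]; exists (j, h) => /=; split=> //.
  by case: j; rewrite !inE.
by rewrite IH e.
Qed.

Lemma uniq_bits L : uniq (bits L).
Proof.
elim: L => // L IH; apply: allpairs_uniq => //.
by move=> [j h] [j' h'] _ _ /= [-> ->].
Qed.

Fixpoint bit_rows L n : seq (seq (seq bool)) :=
  if n is n'.+1 then [seq h :: H | h <- bits L, H <- bit_rows L n']
  else [:: [::]].

Lemma mem_bit_rows L n H :
  (H \in bit_rows L n) = (size H == n) && all (fun h => size h == L) H.
Proof.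
elim: n H => [|n IH] H; first by rewrite inE; case: H.
apply/allpairsP/andP => [[[h H'] /= [hh hH ->]]|].
  by move: hh hH; rewrite mem_bits IH /= eqSS => -> /andP[-> ->].
case: H => [[]//|h H] /= [eH /andP[eh aH]]; exists (h, H) => /=.
by rewrite mem_bits IH eh aH -eqSS eH.
Qed.

Lemma uniq_bit_rows L n : uniq (bit_rows L n).
Proof.
elim: n => // n IH; apply: allpairs_uniq => //; first exact: uniq_bits.
by move=> [j h] [j' h'] _ _ /= [-> ->].
Qed.

(* [below j h bs] is the occupation below a row with horizontal arrows
   [j :: h] and occupation [bs] above it; a truncated subtraction only occurs
   at vertices of weight 0. *)
Fixpoint below j h bs : seq nat :=
  match h, bs with
  | j' :: h', b :: bs' => (b + j' - j)%N :: below j' h' bs'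
  | _, _ => [::]
  end.

(** The final factor excludes an arrow leaving through the right boundary. *)
Fixpoint row_weight x u j h bs : F :=
  match h, bs with
  | j' :: h', b :: bs' =>
      vertex_weight q (xi x * u) (s x) (b + j' - j) j b j'
        * row_weight x.+1 u j' h' bs'
  | _, _ => (~~ j)%:R
  end.

(** Arrow conservation determines the state below from the state above and the horizontal edges, so
    summing over these edges suffices. *)
Lemma row_bits x j u f bs :
  row q xi s x j u f bs =
  \sum_(h <- bits (size bs)) row_weight x u j h bs * f (below j h bs).
Proof.
elim: bs x j f => [|b bs IH] x j f.
  by rewrite big_seq1; case: j; rewrite /= ?mul0r ?mul1r.
rewrite [bits _]/= cats0 big_cat !big_map /= /den.
have E j' : \sum_(h <- bits (size bs))
    vertex_weight q (xi x * u) (s x) (b + j' - j) j b j'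
      * row_weight x.+1 u j' h bs * f ((b + j' - j)%N :: below j' h bs)
   = vertex_weight q (xi x * u) (s x) (b + j' - j) j b j'
     * row q xi s x.+1 j' u (fun c => f ((b + j' - j)%N :: c)) bs.
  by rewrite IH mulr_sumr; apply: eq_bigr => h _; rewrite mulrA.
rewrite (E false) (E true) {E} /vertex_weight.
case: j => /=; rewrite ?addn0 ?addn1 ?subn0 ?subn1 /=.
  by case: b => [|b] /=; rewrite ?eqxx ?expr0 ?subrr ?mulrA ?mul0r.
by rewrite !eqxx -!mulrA.
Qed.

(** [H] lists the rows from the top one downwards. *)
Fixpoint base j H bs : seq nat :=
  if H is h :: H' then base j H' (below j h bs) else bs.

Fixpoint rows_weight us j H bs : F :=
  match us, H with
  | u :: us', h :: H' => row_weight 0 u j h bs * rows_weight us' j H' (below j h bs)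
  | _, _ => 1
  end.

Lemma size_below j h bs : size h = size bs -> size (below j h bs) = size bs.
Proof. by elim: h bs j => [|j' h IH] [|b bs] j //= [] /IH->. Qed.

Lemma size_base j H bs :
  all (fun h => size h == size bs) H -> size (base j H bs) = size bs.
Proof.
elim: H bs => //= h H IH bs /andP[/eqP e a].
by rewrite IH size_below.
Qed.

Lemma rows_bits j us f bs :
  foldr (row q xi s 0 j) f us bs =
  \sum_(H <- bit_rows (size bs) (size us))
     rows_weight us j H bs * f (base j H bs).
Proof.
elim: us bs => [|u us IH] bs; first by rewrite big_seq1 mul1r.
rewrite [foldr _ _ _]/= row_bits [bit_rows _ _]/= big_allpairs_dep.
apply: eq_big_seq => h; rewrite mem_bits => /eqP hh.
rewrite IH size_below // mulr_sumr; apply: eq_bigr => H _ /=.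
by rewrite mulrA.
Qed.

Lemma nth_below j h bs x : size h = size bs -> (x < size bs)%N ->
  nth 0%N (below j h bs) x =
  (nth 0%N bs x + nth false h x - nth false (j :: h) x)%N.
Proof.
elim: h bs j x => [|j' h IH] [|b bs] j [|x] //= [e] hx; exact: IH.
Qed.

Lemma row_weightE x u j h bs : size h = size bs ->
  row_weight x u j h bs =
  (\prod_(i < size bs) vertex_weight q (xi (x + i)%N * u) (s (x + i)%N)
     (nth 0%N (below j h bs) i) (nth false (j :: h) i)
     (nth 0%N bs i) (nth false h i)) * (~~ last j h)%:R.
Proof.
elim: h bs j x => [|j' h IH] [|b bs] j x //= e; first by rewrite big_ord0 mul1r.
rewrite big_ord_recl /= addn0 IH; last by case: e.
by rewrite mulrA; congr (_ * _ * _); apply: eq_bigr => i _; rewrite addSnnS.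
Qed.

Lemma rows_weightE us j H bs : size H = size us ->
  rows_weight us j H bs =
  \prod_(i < size us)
    row_weight 0 (nth 0 us i) j (nth [::] H i) (base j (take i H) bs).
Proof.
elim: us H bs => [|u us IH] [|h H] bs //=; first by rewrite big_ord0.
by case=> e; rewrite big_ord_recl /= IH.
Qed.

Lemma base_rcons j H h bs : base j (rcons H h) bs = below j h (base j H bs).
Proof. by elim: H bs => //= h' H IH bs. Qed.

Lemma base_take j H bs i : (i < size H)%N ->
  base j (take i.+1 H) bs = below j (nth [::] H i) (base j (take i H) bs).
Proof. by move=> hi; rewrite (take_nth [::] hi) base_rcons. Qed.

Lemma vertex_weight00 x u : den xi s x u != 0 ->
  vertex_weight q (xi x * u) (s x) 0 false 0 false = 1.
Proof. by rewrite /den /vertex_weight eqxx expr0 mulr1 mulrA => h; rewrite divff. Qed.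

Lemma vertex_weight_neq0 u t i1 j1 i2 j2 :
  vertex_weight q u t i1 j1 i2 j2 != 0 -> (i1 + j1 = i2 + j2)%N.
Proof.
by case: j1 j2 => [] [] /=; case: ifP => [/eqP->|]; rewrite ?eqxx // ?addn0 ?addn1.
Qed.

Lemma row_prod_trunc L u (a b : nat -> nat) (h : nat -> bool) :
  (forall x, den xi s x u != 0) ->
  (forall x, (L <= x)%N -> [/\ a x = 0%N, b x = 0%N & h x = false]) ->
  \big[*%R/1]_(x \in [set: nat]%classic)
    vertex_weight q (xi x * u) (s x) (a x) (h x) (b x) (h x.+1) =
  \prod_(x < L) vertex_weight q (xi x * u) (s x) (a x) (h x) (b x) (h x.+1).
Proof.
move=> hu h0.
rewrite (fsbig_ord _ _ (fun x =>
  vertex_weight q (xi x * u) (s x) (a x) (h x) (b x) (h x.+1))).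
symmetry; apply: fsbig_widen => // x [_ /= /negP]; rewrite -leqNgt => hx.
have [-> -> ->] := h0 x hx; have [_ _ ->] := h0 x.+1 (leqW hx).
exact: vertex_weight00.
Qed.

End PathSums.

Section Configurations.
Context {F : fieldType} (q : F) (xi s : nat -> F).
Context (n : nat) (u : 'I_n -> F).
Context (hu : forall x y, den xi s x (u y) != 0).

(** Configurations number their rows from the bottom and [H] from the top, hence the subtractions
    from [n]. *)
Definition config_of (j : bool) (bs : seq nat) (H : seq (seq bool)) : config n :=
  (fun (y : 'I_n.+1) x => nth 0%N (base j (take (n - y) H) bs) x,
   fun (y : 'I_n) x => nth false (j :: nth [::] H (n - y.+1)) x).

Lemma config_of_inj j bs :
  {in bit_rows (size bs) n &, injective (config_of j bs)}.
Proof.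
move=> H H'; rewrite !mem_bit_rows => /andP[/eqP sH /allP aH] /andP[/eqP sH' /allP aH'].
move=> [_ e]; apply: (@eq_from_nth _ [::]); rewrite sH ?sH' // => i hi.
have hi' : (n - (n - i.+1).+1 = i)%N by rewrite subnSK // subKn // ltnW.
have hn : (n - i.+1 < n)%N by rewrite ltn_subrL /= (leq_ltn_trans _ hi).
have sz : size (nth [::] H i) = size bs by apply/eqP/aH/mem_nth; rewrite sH.
have sz' : size (nth [::] H' i) = size bs by apply/eqP/aH'/mem_nth; rewrite sH'.
apply: (@eq_from_nth _ false); rewrite sz ?sz' // => x hx.
have := congr1 (fun g => g (Ordinal hn) x.+1) e; by rewrite /= hi'.
Qed.

Lemma config_of_weight j bs H : H \in bit_rows (size bs) n ->
  config_weight q xi s u (config_of j bs H) =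
  rows_weight q xi s (codom (fun i => u (rev_ord i))) j H bs.
Proof.
rewrite mem_bit_rows => /andP[/eqP sH aH].
have sz : size (codom (fun i => u (rev_ord i))) = n by rewrite size_codom card_ord.
rewrite rows_weightE ?sz // /config_weight (reindex_inj rev_ord_inj) /=.
apply: eq_bigr => i _.
have hi := ltn_ord i.
have -> : nth 0 (codom (fun i => u (rev_ord i))) i = u (rev_ord i).
  by rewrite codomE (nth_map i) ?size_enum_ord // nth_ord_enum.
have hi' : (n - (n - i.+1).+1 = i)%N by rewrite subnSK // subKn // ltnW.
have hi2 : (n - (n - i.+1) = i.+1)%N by rewrite subKn.
have hn : (n - i.+1 < n)%N by rewrite ltn_subrL /= (leq_ltn_trans _ hi).
rewrite !inordK ?ltnS ?(ltnW hn) //= hi' hi2.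
rewrite base_take ?sH //.
set bs' := base j (take i H) bs; set h := nth [::] H i.
have sb : size bs' = size bs.
  apply: size_base; apply/allP => h' /mem_take hh; exact: (allP aH).
have sh : size h = size bs' by rewrite sb; apply/eqP/(allP aH)/mem_nth; rewrite sH.
(* One column beyond [bs] is kept: its vertex has weight 1 or 0 according to whether the last edge
   is empty, which is the boundary factor of [row_weight]. *)
rewrite row_weightE // (row_prod_trunc (L := (size bs').+1) q) ?big_ord_recr /=; last first.
- move=> x hx; rewrite !nth_default //= ?size_below ?sh // ltnW //.
- by move=> x; apply: hu.
congr (_ * _).
rewrite -[in nth false (j :: h) _]sh -last_nth !nth_default ?size_below ?sh //.
by case: (last j h) => //; apply: vertex_weight00; apply: hu.
Qed.

Lemma finite_bound (T : choiceType) (A : set (T * nat)) : finite_set A ->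
  exists X, forall p, A p -> (p.2 < X)%N.
Proof.
move=> /finite_seqP[r ->]; exists (\max_(p <- r) p.2).+1 => p /= hp.
by rewrite ltnS; apply: leq_bigmax_seq.
Qed.

Section Boundary.
Context (K M L : nat) (la : signature K) (mu : signature M) (j : bool).
Context (la_lt : forall x, (L <= x)%N -> mult x la = 0%N).
Context (mu_lt : forall x, (L <= x)%N -> mult x mu = 0%N).
Let bs := mkseq (fun x => mult x mu) L.

Lemma config_of_configs H : H \in bit_rows L n ->
  base j H bs = mkseq (fun x => mult x la) L ->
  configs la mu j (config_of j bs H).
Proof.
rewrite mem_bit_rows => /andP[/eqP sH aH] eb.
have sb : size bs = L by rewrite size_mkseq.
split=> /=.
- apply: (@sub_finite_set _ _ ([set: 'I_n.+1] `*` `I_L)%classic) => [[y x] /= hx|].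
    split=> //=; rewrite ltnNge; apply/negP => hL; apply: hx.
    rewrite nth_default // size_base ?sb //.
    by apply/allP => h /mem_take hh; exact: (allP aH).
  by apply: finite_setX.
- apply: (@sub_finite_set _ _ ([set: 'I_n] `*` `I_L.+1)%classic) => [[y x] /= hx|].
    split=> //=; rewrite ltnNge; apply/negP => hL; move: hx.
    rewrite nth_default //=.
    have -> : size (nth [::] H (n - y.+1)) = L; last by [].
    apply/eqP/(allP aH)/mem_nth; rewrite sH ltn_subrL /=.
    by apply: leq_ltn_trans (ltn_ord y).
  by apply: finite_setX.
- move=> x; rewrite subn0 take_oversize ?sH // eb.
  case: (ltnP x L) => hx; first by rewrite nth_mkseq.
  by rewrite nth_default ?size_mkseq // la_lt.
- move=> x; rewrite subnn take0 /=.
  case: (ltnP x L) => hx; first by rewrite nth_mkseq.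
  by rewrite nth_default ?size_mkseq // mu_lt.
- by [].
Qed.

(** Nonzero weight forces conservation at every vertex. Hence no arrow visits a column from [L] on,
    and the horizontal edges determine the configuration. *)
Lemma configs_config_of c : configs la mu j c -> config_weight q xi s u c != 0 ->
  exists H, [/\ H \in bit_rows L n,
                base j H bs = mkseq (fun x => mult x la) L & c = config_of j bs H].
Proof.
move=> [fa fh hla hmu hj] hw.
have [X1 hX1] := finite_bound fa; have [X2 hX2] := finite_bound fh.
have a0 y x : (X1 <= x)%N -> c.1 y x = 0%N.
  by move=> hx; apply: contrapT => /(hX1 (y, x)); rewrite /= ltnNge hx.
have h0 y x : (X2 <= x)%N -> c.2 y x = false.
  by move=> hx; apply/negP => /(hX2 (y, x)); rewrite /= ltnNge hx.
have cons y x : (c.1 (inord (nat_of_ord y)) x + c.2 y x =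
    c.1 (inord y.+1) x + c.2 y x.+1)%N.
  have hwy : \big[*%R/1]_(x \in [set: nat]%classic) vertex_weight q (xi x * u y) (s x)
      (c.1 (inord (nat_of_ord y)) x) (c.2 y x) (c.1 (inord y.+1) x) (c.2 y x.+1) != 0.
    by move: hw; rewrite /config_weight (bigD1 y) //= mulf_eq0 negb_or => /andP[].
  rewrite (row_prod_trunc (L := maxn X1 X2) q) in hwy; last first.
  - by move=> z; rewrite geq_max => /andP[? ?]; rewrite !a0 ?h0.
  - by move=> z; apply: hu.
  case: (ltnP x (maxn X1 X2)) => hx.
    apply: (@vertex_weight_neq0 _ q (xi x * u y) (s x)).
    by move: hwy; rewrite (bigD1 (Ordinal hx)) //= mulf_eq0 negb_or => /andP[].
  move: hx; rewrite geq_max => /andP[? hx]; rewrite !a0 ?h0 //; exact: leqW.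
(* Within a row, induction runs leftwards from column [X2], past which all edges are empty: a vertex
   with nothing going out has nothing coming in. *)
have step (y : 'I_n) : (forall x, (L <= x)%N -> c.1 (inord y.+1) x = 0%N) ->
    forall x, (L <= x)%N -> c.1 (inord y) x = 0%N /\ c.2 y x = false.
  move=> hy x hx; have [d hd] : exists d, (X2 <= x + d)%N.
    by exists X2; rewrite leq_addl.
  elim: d x hx hd => [|d IH] x hx hd.
    have hh : c.2 y x = false by apply: h0; rewrite -(addn0 x).
    split=> //; have := cons y x; rewrite hh hy //.
    by rewrite h0 ?addn0 //; apply: leqW; rewrite -(addn0 x).
  have hd' : (X2 <= x.+1 + d)%N by rewrite addSnnS.
  have [_ hh] := IH x.+1 (leqW hx) hd'.
  have := cons y x; rewrite hy // hh => /eqP; rewrite addn_eq0 => /andP[/eqP -> hc].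
  by split=> //; case: (c.2 y x) hc.
have aL d : (d <= n)%N -> forall x, (L <= x)%N -> c.1 (inord (n - d)) x = 0%N.
  elim: d => [_ x hx|d IH hd x hx].
    by rewrite subn0 (_ : inord n = ord_max) ?hmu ?mu_lt //; apply: val_inj; rewrite /= inordK.
  have hn : (n - d.+1 < n)%N by rewrite ltn_subrL /= (leq_ltn_trans _ hd).
  apply: (proj1 (step (Ordinal hn) _ x hx)) => z hz /=; rewrite subnSK //.
  exact: IH (ltnW hd) z hz.
have hL (y : 'I_n) x : (L <= x)%N -> c.2 y x = false.
  move=> hx; apply: (proj2 (step y _ x hx)) => z hz.
  have := aL (n - y.+1)%N (leq_subr _ _) z hz; by rewrite subKn.
(* Extends the edges to all row numbers, with default [false], so that [mkseq] can list them. *)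
pose hN y x := if insub y is Some y' then c.2 (y' : 'I_n) x else false.
have hNE (y : 'I_n) x : hN y x = c.2 y x by rewrite /hN valK.
pose H := mkseq (fun i => mkseq (fun x => hN (n - i.+1)%N x.+1) L) n.
have HR : H \in bit_rows L n.
  rewrite mem_bit_rows size_mkseq eqxx; apply/allP => h /mapP[i _ ->].
  by rewrite size_mkseq.
have bt d : (d <= n)%N -> base j (take d H) bs = mkseq (c.1 (inord (n - d))) L.
  elim: d => [_|d IH hd].
    rewrite take0 /= subn0 /bs; apply: eq_map => x.
    by rewrite -hmu; congr c.1; apply: val_inj; rewrite /= inordK.
  rewrite base_take ?size_mkseq // IH 1?ltnW // nth_mkseq //.
  have hn : (n - d.+1 < n)%N by rewrite ltn_subrL /= (leq_ltn_trans _ hd).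
  have szE : size (mkseq (fun x => hN (n - d.+1)%N x.+1) L) =
    size (mkseq (c.1 (inord (n - d))) L) by rewrite !size_mkseq.
  apply: (@eq_from_nth _ 0%N); rewrite size_below ?size_mkseq // => x hx.
  rewrite nth_below ?size_mkseq // !nth_mkseq //.
  have hc := cons (Ordinal hn) x; rewrite /= subnSK // in hc.
  have -> : nth false (j :: mkseq (fun x => hN (n - d.+1)%N x.+1) L) x = c.2 (Ordinal hn) x.
    case: x hx {hc} => [|x] hx /=; first by rewrite hj.
    by rewrite nth_mkseq 1?ltnW // (hNE (Ordinal hn)).
  by rewrite (hNE (Ordinal hn)) -hc addnK.
exists H; split=> //.
  rewrite -(take_size H) size_mkseq bt // subnn; apply: eq_map => x.
  by rewrite -hla; congr c.1; apply: val_inj; rewrite /= inordK.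
rewrite [LHS]surjective_pairing; congr (_, _); apply/funext => y; apply/funext => x.
  rewrite bt ?leq_subr // subKn; last by rewrite -ltnS.
  rewrite inord_val; case: (ltnP x L) => hx; first by rewrite nth_mkseq.
  rewrite nth_default ?size_mkseq //.
  have := aL (n - y)%N (leq_subr _ _) x hx; rewrite subKn ?inord_val //.
  by rewrite -ltnS.
case: x => [|x] /=; first by rewrite hj.
rewrite /H nth_mkseq; last by rewrite ltn_subrL /= (leq_ltn_trans _ (ltn_ord y)).
rewrite subnSK // subKn 1?ltnW //; case: (ltnP x L) => hx.
  by rewrite nth_mkseq // hNE.
by rewrite nth_default ?size_mkseq // hL // leqW.
Qed.

(** Turns the sums defining F and G into matrix elements of row operators: [config_of] is injective
    on the edge patterns reaching [la] and covers all configurations of nonzero weight. *)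
Lemma configs_sum (f : seq nat -> F) :
  (forall c, size c = L -> f c = (c == mkseq (fun x => mult x la) L)%:R) ->
  \sum_(c \in @configs n K M la mu j) config_weight q xi s u c =
  foldr (row q xi s 0 j) f (codom (fun i => u (rev_ord i))) bs.
Proof.
move=> hf.
have sb : size bs = L by rewrite size_mkseq.
rewrite rows_bits size_codom card_ord sb.
pose r := [seq H <- bit_rows L n | base j H bs == mkseq (fun x => mult x la) L].
transitivity (\sum_(c <- map (config_of j bs) r) config_weight q xi s u c).
  rewrite [RHS]fsbig_seq; last first.
    rewrite map_inj_in_uniq ?filter_uniq ?uniq_bit_rows // => H H'.
    rewrite !mem_filter => /andP[_ hH] /andP[_ hH'].
    by apply: config_of_inj; rewrite sb.
  symmetry; apply: fsbig_widen => [c /= /mapP[H]|c [hc /= hr]].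
    by rewrite mem_filter => /andP[/eqP hb hH] ->; apply: config_of_configs.
  apply/eqP/negPn/negP => /(configs_config_of hc) [H [hH hb ec]].
  by apply: hr; apply/mapP; exists H => //; rewrite mem_filter hb eqxx.
rewrite big_map big_filter big_mkcond; apply: eq_big_seq => H hH.
rewrite hf; last first.
  by rewrite size_base ?sb //; move: hH; rewrite mem_bit_rows => /andP[].
by case: ifP => _; rewrite ?mulr1 ?mulr0 // config_of_weight // sb.
Qed.

End Boundary.
End Configurations.

(** * The formulas for F and G *)

Section Formulas.
Context {F : fieldType} (q : F) (xi s : nat -> F).

Lemma count_columns x bs y :
  count_mem y (columns x bs) = if (x <= y)%N then nth 0%N bs (y - x) else 0%N.
Proof.
elim: bs x => [|b bs IH] x /=; first by rewrite nth_nil; case: ifP.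
rewrite count_cat count_nseq IH /=; case: (ltngtP x y) => hxy.
- by rewrite mul0n add0n -(subnSK hxy).
- by rewrite mul0n.
- by rewrite hxy subnn mul1n addn0.
Qed.

Lemma sorted_columns x bs : sorted leq (columns x bs).
Proof.
elim: bs x => // b bs IH x /=; elim: b => [|b IHb]; first exact: IH.
rewrite /= path_sortedE; last exact: leq_trans.
rewrite IHb andbT; apply/allP => k; rewrite mem_cat mem_nseq.
by move=> /orP[/andP[_ /eqP->]//|/columns_ge/ltnW].
Qed.

Lemma columns_count L (t : seq nat) : sorted leq t -> all (fun x => x < L)%N t ->
  columns 0 (mkseq (fun x => count_mem x t) L) = t.
Proof.
move=> st at_; apply: (sorted_eq leq_trans anti_leq) => //; first exact: sorted_columns.
apply/allP => y _ /=; rewrite count_columns subn0 /=.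
case: (ltnP y L) => hy; first by rewrite nth_mkseq.
rewrite nth_default ?size_mkseq //; apply/eqP; symmetry; apply/count_memPn.
by apply: contraL hy => /(allP at_); rewrite -ltnNge.
Qed.

Lemma mkseq_cons (T : Type) (f : nat -> T) L :
  mkseq f L.+1 = f 0%N :: mkseq (fun x => f x.+1) L.
Proof. by rewrite /mkseq /= (iotaDl 1 0) -map_comp. Qed.

(** The successor keeps column 0 present even for the empty signature. *)
Definition width n (mu : signature n) := (\max_(p <- parts mu) p).+1.

Lemma part_lt_width n (mu : signature n) p : p \in parts mu -> (p < width mu)%N.
Proof. by move=> hp; rewrite ltnS; apply: leq_bigmax_seq. Qed.

Lemma mult_width n (mu : signature n) x : (width mu <= x)%N -> mult x mu = 0%N.
Proof.
move=> hx; apply/count_memPn; apply: contraL hx => /part_lt_width.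
by rewrite -ltnNge.
Qed.

Lemma columns_parts n (mu : signature n) :
  columns 0 (mkseq (fun x => mult x mu) (width mu)) = rev (parts mu).
Proof.
rewrite -[RHS](@columns_count (width mu)).
- by congr columns; apply: eq_map => x; rewrite /mult count_rev.
- by rewrite rev_sorted; case: mu.
- by rewrite all_rev; apply/allP => p; apply: part_lt_width.
Qed.

Lemma mult_zeros n x : mult x (zeros n) = if x is 0 then n else 0%N.
Proof. by rewrite /mult count_nseq; case: x => [|x]; rewrite ?mul1n ?mul0n. Qed.

Lemma vacE bs : vac bs = (bs == nseq (size bs) 0%N)%:R :> F.
Proof. by rewrite /vac (sameP (all_pred1P _ _) eqP). Qed.

Lemma admissible_rows n (u : 'I_n -> F) :
  (forall x i, den xi s x (u i) != 0) ->
  (forall a b : 'I_n, a != b -> u a - u b != 0) ->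
  admissible xi s (codom (fun i => u (rev_ord i))).
Proof.
move=> hu hd; split; last by move=> v /codomP[i ->] y; exact: hu.
apply/injectiveP => i j /eqP e; apply: rev_ord_inj.
by apply: contraTeq e => /hd; rewrite subr_eq0.
Qed.

Lemma phi_from0 k v : phi_from q xi s 0 k v = phi q xi s k v.
Proof. by rewrite /phi_from big_mkord. Qed.

Lemma symmetrize_rev n (f : ('I_n -> F) -> F) (u : 'I_n -> F) :
  symmetrize f u = symmetrize f (fun i => u (rev_ord i)).
Proof.
rewrite -(symmetrize_perm f u (perm (@rev_ord_inj n))).
by congr symmetrize; apply/funext => i; rewrite permE.
Qed.

Lemma Ffun_symmetrize M (mu : signature M) (u : 'I_M -> F) :
  (forall x i, den xi s x (u i) != 0) ->
  (forall a b : 'I_M, a != b -> u a - u b != 0) ->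
  Ffun q xi s mu u =
  symmetrize (fun w => cross q w *
    \prod_(i < M) phi q xi s (nth 0%N (parts mu) i) (w i)) u.
Proof.
move=> hu hd.
rewrite /Ffun /skewF
  (@configs_sum F q xi s M u hu 0 M (width mu) (zeros 0) mu true _ _ (@vac F)).
- rewrite -/(Psi q xi s 0 _) Psi_Sym; last exact: admissible_rows.
  (* The parts come out increasing, which is the last-to-first order of [Sym]; the variables, read
     from the top row, are reversed too. *)
  rewrite columns_parts symmetrize_rev.
  rewrite (symmetrize_Sym q (fun i => phi q xi s (nth 0%N (parts mu) i))).
  rewrite (@eq_Sym _ q _ _ _ (phi q xi s)) => [|k v _ _]; last exact: phi_from0.
  have e : mkseq (nth 0%N (parts mu)) M = parts mu.
    by rewrite -[M in mkseq _ M](size_tuple (val mu)) mkseq_nth.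
  by congr Sym; rewrite !map_rev -[in LHS]e /mkseq -map_comp.
- by move=> x _; rewrite mult_zeros; case: x.
- exact: mult_width.
- move=> c hc; rewrite vacE hc; congr (_ == _)%:R.
  by apply: (@eq_from_nth _ 0%N); rewrite ?size_nseq ?size_mkseq // => i hi;
     rewrite nth_nseq hi nth_mkseq // mult_zeros; case: i hi.
Qed.

Section G.
Context (n : nat) (nu : signature n) (N : nat) (v : 'I_N -> F).
Context (hv : forall x j, den xi s x (v j) != 0).
Let k := mult 0 nu.
Let bs := mkseq (fun x => mult x.+1 nu) (width nu).-1.

Lemma mult0_le : (k <= n)%N.
Proof. by rewrite -[n in (_ <= n)%N](size_tuple (val nu)) count_size. Qed.

Lemma Gfun_Omega :
  Gfun q xi s nu v = Omega q xi s 0 n (codom (fun i => v (rev_ord i))) (k :: bs).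
Proof.
rewrite /Gfun /skewG
  (@configs_sum F q xi s N v hv n n (width nu) (zeros n) nu false _ _ (@start F n)).
- rewrite /Omega; congr (foldr _ _ _ _).
  by rewrite /bs /width mkseq_cons.
- by move=> x hx; rewrite mult_zeros; case: x hx.
- exact: mult_width.
- case=> [//|b c] [hc] /=.
  rewrite vacE hc mkseq_cons eqseq_cons mult_zeros.
  rewrite (_ : mkseq _ _ = nseq (size c) 0%N) ?hc; last first.
    by apply: (@eq_from_nth _ 0%N); rewrite ?size_nseq ?size_mkseq // => i hi;
       rewrite nth_nseq hi nth_mkseq // mult_zeros.
  by case: eqP; rewrite ?mul1r ?mul0r.
Qed.

Lemma Gfun_few : (N < n - k)%N -> Gfun q xi s nu v = 0.
Proof.
move=> h; rewrite Gfun_Omega Omega_few // size_codom card_ord.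
by rewrite addnC -ltn_subRL.
Qed.

Lemma parts_split : parts nu = rev (columns 1 bs) ++ nseq k 0%N.
Proof.
apply: (can_inj revK); rewrite rev_cat revK rev_nseq -columns_parts.
by rewrite /width mkseq_cons.
Qed.

Lemma size_columns_bs : size (columns 1 bs) = (n - k)%N.
Proof.
have := congr1 size parts_split.
by rewrite size_tuple size_cat size_rev size_nseq => ->; rewrite addnK.
Qed.

(** For [z = s 0 ^+ 2], the second factor is the product produced by [Omega_Sym]. *)
Lemma qpoch_split z m l : (l <= m)%N ->
  qpoch z q m = qpoch z q l * \prod_(i < m - l) (1 - z * q ^+ (l + i)).
Proof.
move=> hl; rewrite /qpoch -(big_mkord xpredT (fun i => 1 - z * q ^+ i)).
rewrite (big_cat_nat (n := l)) //= big_mkord; congr (_ * _).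
by rewrite -{1}[l]add0n big_addn big_mkord; apply: eq_bigr => i _; rewrite addnC.
Qed.

Lemma Gfun_symmetrize : q != 0 -> (n - k <= N)%N ->
  (forall a b : 'I_N, a != b -> v a - v b != 0) ->
  ((0 < n - k)%N -> forall j : 'I_N, xi 0%N * v j - s 0%N != 0) ->
  qpoch q q (N + k - n) != 0 -> qpoch (s 0%N ^+ 2) q k != 0 ->
  Gfun q xi s nu v =
  qpoch (s 0%N ^+ 2) q n / (qpoch q q (N + k - n) * qpoch (s 0%N ^+ 2) q k) *
  symmetrize (fun w : 'I_N -> F =>
    cross q w *
    \prod_(j < N) phi q xi s (nth 0%N (parts nu) j) (w j) *
    \prod_(i < N | (i < n - k)%N) (xi 0%N * w i / (xi 0%N * w i - s 0%N)) *
    \prod_(j < N | (n - k <= j)%N) (1 - s 0%N * q ^+ k * xi 0%N * w j)) v.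
Proof.
move=> hq hN hd hxs qm qk; set m := (N + k - n)%N in qm *.
set us := codom (fun i => v (rev_ord i)).
have ha : admissible xi s us by apply: admissible_rows.
have hsz : (size us + k = n + m)%N.
  rewrite size_codom card_ord /m subnKC //.
  by rewrite addnC -leq_subLR.
have := Omega_Sym 0 bs ha hq hsz mult0_le; rewrite -Gfun_Omega => E.
rewrite (qpoch_split _ mult0_le).
apply: (mulfI qm); rewrite E.
set P := \prod_(i < n - k) _; set Sy := symmetrize _ _.
transitivity (P * Sy); last by field; rewrite qm qk.
congr (_ * _); rewrite /Sy symmetrize_rev.
(* [h] collects the factors attached to index [j] in the statement, and [h'] below those coming from
   [Omega_Sym]. *)
pose h j x := phi q xi s (nth 0%N (parts nu) j) x *
  (if (j < n - k)%N then xi 0%N * x / (xi 0%N * x - s 0%N)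
   else 1 - s 0%N * q ^+ k * xi 0%N * x).
transitivity (symmetrize (fun w : 'I_N -> F => cross q w * \prod_(j < N) h j (w j))
    (fun i => v (rev_ord i))); last first.
  rewrite /symmetrize; apply: eq_bigr => sg _.
  rewrite -!(mulrA (cross _ _)); congr (_ * _).
  rewrite big_split -[RHS]mulrA /=; congr (_ * _).
  rewrite [X in _ = X * _]big_mkcond [X in _ = _ * X]big_mkcond -big_split /=.
  by apply: eq_bigr => j _; case: ltnP; rewrite ?mulr1 ?mul1r.
rewrite symmetrize_Sym -/us.
pose h' j x := if (j < n - k)%N
  then xi 0%N * x / den xi s 0 x * phi_from q xi s 1 (nth 0%N (parts nu) j) x
  else (1 - q) / den xi s 0 x * (1 - s 0%N * q ^+ k * xi 0%N * x).
transitivity (Sym q [seq h' i | i <- rev (iota 0 N)] us).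
  congr Sym; have -> : N = (n - k + m)%N.
    by apply/eqP; rewrite -(eqn_add2r k) addnAC subnK ?mult0_le // -hsz size_codom card_ord.
  rewrite iotaD rev_cat map_cat; congr (_ ++ _).
    rewrite map_rev add0n; transitivity (rev (nseq m (h' (n - k)%N))).
      by rewrite rev_nseq /h' ltnn.
    congr rev; apply: (@eq_from_nth _ (h' 0%N));
      rewrite size_nseq ?size_map ?size_iota // => i hi.
    rewrite nth_nseq hi (nth_map 0%N) ?size_iota // nth_iota //.
    by rewrite /h' ltnn ltnNge leq_addr.
  have sP : size (rev (columns 1 bs)) = (n - k)%N by rewrite size_rev size_columns_bs.
  have eP := parts_split; rewrite -[columns 1 bs]revK.
  move: (rev (columns 1 bs)) sP eP => Q sP eP; rewrite !map_rev; congr rev.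
  rewrite -[in LHS](mkseq_nth 0%N Q) sP /mkseq -map_comp; apply/eq_in_map => i.
  by rewrite mem_iota add0n => /andP[_ hi] /=; rewrite /h' hi eP nth_cat sP hi.
apply: eq_Sym => j x _ /codomP[i ->].
rewrite /h' /h; case: ltnP => hj; last first.
  rewrite parts_split nth_cat size_rev size_columns_bs ltnNge hj /= nth_nseq if_same.
  by rewrite /phi big_ord0 mulr1.
(* As this part is positive, φ contains the column 0 factor, whose numerator cancels the denominator
   [xi 0 * x - s 0]. *)
set c := nth _ _ _; have hc : (0 < c)%N.
  rewrite /c parts_split nth_cat size_rev size_columns_bs hj.
  apply: (@columns_ge 1 bs); rewrite -mem_rev; apply: mem_nth.
  by rewrite size_rev size_columns_bs.
have hx := hxs (leq_ltn_trans (leq0n _) hj) (rev_ord i).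
rewrite -phi_from0 /phi_from (big_ltn hc).
move: (hv 0 (rev_ord i)) (hv c (rev_ord i)); rewrite /den => d0 dc.
by field; rewrite hx d0 dc.
Qed.

End G.
End Formulas.

Theorem theorem4p14 (R : realType) (q : R[i]) (xi s : nat -> R[i])
    (hq : q != 0) (hxi : forall j, xi j != 0) (hs : forall j, s j != 0) :
  (forall (M : nat) (mu : signature M) (u : 'I_M -> R[i]),
     (forall (x : nat) (i : 'I_M), 1 - s x * xi x * u i != 0) ->
     (forall a b : 'I_M, a != b -> u a - u b != 0) ->
     Ffun q xi s mu u =
     symmetrize (fun w : 'I_M -> R[i] =>
       cross q w * \prod_(i < M) phi q xi s (nth 0%N (parts mu) i) (w i)) u)
  /\
  (forall (n : nat) (nu : signature n) (N : nat) (v : 'I_N -> R[i]),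
     let k := mult 0 nu in
     (forall (x : nat) (j : 'I_N), 1 - s x * xi x * v j != 0) ->
     ((n - k <= N)%N ->
      (forall a b : 'I_N, a != b -> v a - v b != 0) ->
      ((0 < n - k)%N -> forall j : 'I_N, xi 0%N * v j - s 0%N != 0) ->
      qpoch q q (N + k - n) != 0 ->
      qpoch (s 0%N ^+ 2) q k != 0 ->
      Gfun q xi s nu v =
      qpoch (s 0%N ^+ 2) q n /
        (qpoch q q (N + k - n) * qpoch (s 0%N ^+ 2) q k) *
      symmetrize (fun w : 'I_N -> R[i] =>
        cross q w *
        \prod_(j < N) phi q xi s (nth 0%N (parts nu) j) (w j) *
        \prod_(i < N | (i < n - k)%N) (xi 0%N * w i / (xi 0%N * w i - s 0%N)) *
        \prod_(j < N | (n - k <= j)%N) (1 - s 0%N * q ^+ k * xi 0%N * w j)) v)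
     /\
     ((N < n - k)%N -> Gfun q xi s nu v = 0)).
Proof.
split=> [M mu u hu hd|n nu N v k hv]; first exact: Ffun_symmetrize.
split=> [hN hd hx qm qk|]; last exact: Gfun_few.
exact: Gfun_symmetrize.
Qed.
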